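(* For each finite simple graph $G$ of order $n\geq 2$, each integer $\alpha\geq 0$ and each integer $t\geq 1$, the general first Zagreb index of the generalized Sierpiński graph $S(G,t)$ is given by $$Z_\alpha(S(G,t)) = \frac{n^t-n^{t-1}+(n^{t-1}-1)\alpha}{n-1}\, Z_\alpha(G) + \frac{n^{t-1}-1}{n-1}\sum_{j=1}^{\alpha-1}\binom{\alpha}{j-1} Z_j(G).$$
   Context: All graphs are finite and simple. $\deg_G(v)$ is the degree of $v$ in $G$. General first Zagreb index: for a graph $G$, $Z_\alpha(G)=\sum_{u\in V(G)}(\deg_G(u))^\alpha$, with the convention $0^0=1$ (so that $Z_0(G)=|V(G)|$). A sum whose upper limit is smaller than its lower limit is empty and equals $0$. Generalized Sierpiński graph: let $G=(V,E)$ be a graph of order $n\geq 2$ and $t$ a positive integer. Let $V^t$ be the set of words ${\bf u}=u_1u_2\ldots u_t$ of length $t$ on the alphabet $V$. The generalized Sierpiński graph of $G$ of dimension $t$, denoted $S(G,t)$, is the graph with vertex set $V^t$ in which $\{{\bf u},{\bf v}\}$ is an edge if and only if there exists $i\in\{1,\ldots,t\}$ such that: (i) $u_j=v_j$ for all $j<i$; (ii) $u_i\neq v_i$ and $\{u_i,v_i\}\in E(G)$; (iii) $u_j=v_i$ and $v_j=u_i$ for all $j>i$. *)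

(* Defs.v *)
From HB Require Import structures.
From mathcomp Require Import all_boot all_order all_algebra.

Set Implicit Arguments.
Unset Strict Implicit.
Unset Printing Implicit Defensive.

Record sgraph := SGraph {
  vertex :> finType;
  adj : rel vertex;
  adj_sym : symmetric adj;
  adj_irr : irreflexive adj
}.

Definition deg (G : sgraph) (v : G) : nat := #|[set w : G | adj v w]|.

(* [0 ^ 0 = 1] for [expn], so [zagreb 0 G = #|G|]. *)
Definition zagreb (alpha : nat) (G : sgraph) : nat :=
  \sum_(u : G) deg u ^ alpha.

Definition sierpinski_adj (G : sgraph) (t : nat) : rel (t.-tuple G) :=
  fun u v => [exists i : 'I_t,
    [&& [forall j : 'I_t, (j < i) ==> (tnth u j == tnth v j)],
        tnth u i != tnth v i,
        adj (tnth u i) (tnth v i)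
      & [forall j : 'I_t, (i < j) ==>
           (tnth u j == tnth v i) && (tnth v j == tnth u i)]]].

Lemma sierpinski_adj_sym (G : sgraph) (t : nat) :
  symmetric (@sierpinski_adj G t).
Proof.
move=> u v; apply: eq_existsb => i; rewrite eq_sym adj_sym; congr [&& _, _, _ & _].
  by apply: eq_forallb => j; rewrite eq_sym.
by apply: eq_forallb => j; rewrite andbC.
Qed.

Lemma sierpinski_adj_irr (G : sgraph) (t : nat) :
  irreflexive (@sierpinski_adj G t).
Proof. by move=> u; apply/existsP => -[i]; rewrite eqxx andbF. Qed.

Definition sierpinski (G : sgraph) (t : nat) : sgraph :=
  @SGraph (t.-tuple G) (@sierpinski_adj G t)
    (@sierpinski_adj_sym G t) (@sierpinski_adj_irr G t).

(* Main.v *)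
Require Import Defs.
From HB Require Import structures.
From mathcomp Require Import all_boot all_order all_algebra.
From mathcomp Require Import ring.

(** Splitting off the first letter of a word makes everything recursive.  An
    edge of [S(G, t+1)] between [x u] and [y v] either lies inside one copy of
    [S(G, t)] ([x = y] and [u ~ v]) or joins the copies of two adjacent letters
    [x ~ y] at their extreme vertices ([u = y^t] and [v = x^t]); this is
    [sierpinski_adj_cons].  Hence, for [t > 0], prefixing [x] to [u] leaves the
    degree of [u] unchanged, unless [u] is an extreme vertex [y^t] with [y ~ x],
    in which case it grows by one ([deg_cons]).  The extreme vertex [y^t] has
    degree [deg y] ([deg_extreme]) and there are [deg y] letters [x] adjacent to
    [y], so that
    [Z_alpha (S(G, t+1)) = n * Z_alpha (S(G, t)) + K], where
    [K = \sum_y deg y * ((deg y + 1)^alpha - (deg y)^alpha)].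
    The number [K] does not depend on [t], so unfolding the recursion from
    [S(G, 1)], which has the degrees of [G], yields
    [Z_alpha (S(G, t+1)) = n^t Z_alpha(G) + (1 + n + ... + n^(t-1)) K]
    ([zagreb_sierpinski]).  The binomial formula gives
    [K = \sum_(1 <= j <= alpha) 'C(alpha, j-1) Z_j(G)] ([zagreb_incrE]); its term
    [j = alpha] is [alpha * Z_alpha(G)], and summing the geometric series gives
    the closed form. *)

Set Implicit Arguments.
Unset Strict Implicit.
Unset Printing Implicit Defensive.

Import GRing.Theory.
Local Open Scope ring_scope.

Lemma deg_sum (G : sgraph) (v : G) : deg v = (\sum_(w : G) adj v w)%N.
Proof. by rewrite /deg cardsE -sum1_card big_mkcond. Qed.

Lemma sum_tuple_cons (T : finType) (t : nat) (F : t.+1.-tuple T -> nat) :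
  (\sum_w F w = \sum_x \sum_(u : t.-tuple T) F [tuple of x :: u])%N.
Proof.
rewrite pair_big /=.
rewrite (reindex (fun p : T * t.-tuple T => [tuple of p.1 :: p.2])) //=.
exists (fun w => (thead w, [tuple of behead w])) => [[x u]|w] _ /=.
  by rewrite theadE; congr pair; apply: val_inj.
by rewrite -tuple_eta.
Qed.

Lemma sum_delta (T : finType) (a : T) (F : T -> nat) :
  (\sum_x (x == a) * F x = F a)%N.
Proof.
rewrite (bigD1 a) //= eqxx mul1n big1 ?addn0 // => x /negbTE ->.
by rewrite mul0n.
Qed.

Lemma eq_nseq_tuple (T : eqType) (t : nat) (u : t.-tuple T) (y : T) :
  (u == [tuple of nseq t y]) = [forall j, tnth u j == y].
Proof.
apply/eqP/forallP => [-> j|H]; first by rewrite tnth_nseq.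
by apply: eq_from_tnth => j; rewrite tnth_nseq; apply/eqP.
Qed.

Lemma nseq_tuple_eq (T : eqType) (t : nat) (y z : T) :
  ([tuple of nseq t.+1 y] == [tuple of nseq t.+1 z]) = (y == z).
Proof.
rewrite eq_nseq_tuple; apply/forallP/eqP => [/(_ ord0)|-> j].
  by rewrite tnth_nseq => /eqP.
by rewrite tnth_nseq.
Qed.

(** The two disjuncts correspond to the position where the words start to
    differ being a later one or the first one. *)
Lemma sierpinski_adj_cons (G : sgraph) (t : nat) (x y : G) (u v : t.-tuple G) :
  @sierpinski_adj G t.+1 [tuple of x :: u] [tuple of y :: v] =
  (x == y) && sierpinski_adj u v
  || [&& adj x y, u == [tuple of nseq t y] & v == [tuple of nseq t x]].
Proof.
apply/existsP/orP => [[i /and4P [/forallP Hl Hn Ha /forallP Hr]]|].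
- case: (unliftP ord0 i) Hl Hn Ha Hr => [k|] -> Hl Hn Ha Hr.
    left; move: (Hl ord0); rewrite !tnth0 /= => /eqP ->; rewrite eqxx /=.
    apply/existsP; exists k; move: Hn Ha; rewrite !tnthS => -> ->.
    apply/and4P; split=> //; apply/forallP => j.
      by move: (Hl (lift ord0 j)); rewrite !tnthS.
    by move: (Hr (lift ord0 j)); rewrite !tnthS.
  right; move: Ha; rewrite !tnth0 => ->; rewrite !eq_nseq_tuple /=.
  by apply/andP; split; apply/forallP => j;
    move: (Hr (lift ord0 j)); rewrite !tnthS !tnth0 /= => /andP [].
- case=> [/andP [/eqP <- /existsP [k /and4P [/forallP Hl Hn Ha /forallP Hr]]]|].
    exists (lift ord0 k); rewrite !tnthS Hn Ha.
    apply/and4P; split=> //; apply/forallP => j.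
      case: (unliftP ord0 j) => [l|] ->; last by rewrite !tnth0 eqxx implybT.
      by move: (Hl l); rewrite !tnthS.
    case: (unliftP ord0 j) => [l|] -> //.
    by move: (Hr l); rewrite !tnthS.
  rewrite !eq_nseq_tuple => /and3P [Ha /forallP Hu /forallP Hv].
  exists ord0; rewrite !tnth0 Ha.
  have -> : x != y by apply: contraTneq Ha => ->; rewrite adj_irr.
  apply/and4P; split=> //; apply/forallP => j //.
  case: (unliftP ord0 j) => [l|] -> //.
  by rewrite !tnthS Hu Hv.
Qed.

(** The sum over [y] is 0 or 1 when [t > 0].  Written as a sum, the correction
    also covers the empty word, where it counts all neighbours of [x] and so
    gives the degrees of [S(G, 1)]. *)
Lemma deg_cons (G : sgraph) (t : nat) (x : G) (u : t.-tuple G) :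
  @deg (sierpinski G t.+1) [tuple of x :: u] =
  (@deg (sierpinski G t) u
   + \sum_(y : G) (adj x y && (u == [tuple of nseq t y])))%N.
Proof.
rewrite deg_sum sum_tuple_cons /=.
have E y : (\sum_(v : t.-tuple G)
      @sierpinski_adj G t.+1 [tuple of x :: u] [tuple of y :: v] =
    (y == x) * @deg (sierpinski G t) u
    + (adj x y && (u == [tuple of nseq t y])))%N.
  rewrite deg_sum big_distrr /=.
  rewrite -[X in (_ + X)%N](sum_delta [tuple of nseq t x]
    (fun=> (adj x y && (u == [tuple of nseq t y]) : nat))).
  rewrite -big_split; apply: eq_bigr => v _ /=.
  rewrite sierpinski_adj_cons eq_sym.
  case: eqVneq => [->|_]; first by rewrite adj_irr /= orbF mul1n muln0 addn0.
  rewrite /= andbA andbC.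
  by do 2!case: (_ == _) => //=; rewrite ?andbF ?andbT //=; case: adj.
rewrite (eq_bigr _ (fun y _ => E y)) big_split /=; congr addn.
exact: sum_delta.
Qed.

Lemma deg_sierpinski0 (G : sgraph) (u : 0.-tuple G) :
  @deg (sierpinski G 0) u = 0%N.
Proof.
rewrite deg_sum big1 // => v _; rewrite [adj _ _]/= /sierpinski_adj.
by case: existsP => // -[[]].
Qed.

Lemma deg_sierpinski1 (G : sgraph) (x : G) (u : 0.-tuple G) :
  @deg (sierpinski G 1) [tuple of x :: u] = deg x.
Proof.
rewrite deg_cons deg_sierpinski0 deg_sum; apply: eq_bigr => y _.
by rewrite (tuple0 u) (tuple0 [tuple of nseq 0 y]) eqxx andbT.
Qed.

(** Prefixing [y] to [y^t] adds nothing, since [y] is not its own neighbour. *)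
Lemma deg_extreme (G : sgraph) (t : nat) (y : G) :
  @deg (sierpinski G t.+1) [tuple of nseq t.+1 y] = deg y.
Proof.
have E s : [tuple of nseq s.+1 y] = [tuple of y :: [tuple of nseq s y]].
  exact: val_inj.
elim: t => [|t IH]; rewrite E; first exact: deg_sierpinski1.
rewrite deg_cons IH big1 ?addn0 // => z _; rewrite nseq_tuple_eq.
by case: eqVneq => [->|_]; rewrite ?adj_irr ?andbF.
Qed.

(** The difference [(d + 1)^a - d^a], by the binomial formula, as a sum so that
    no truncated subtraction appears. *)
Definition pow_incr (a d : nat) : nat := (\sum_(k < a) 'C(a, k) * d ^ k)%N.

Lemma expn_addn1 (a d : nat) : ((d + 1) ^ a = d ^ a + pow_incr a d)%N.
Proof.
rewrite addnC expnDn big_ord_recr /= subnn binn mul1n expn0 mul1n addnC.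
by congr addn; apply: eq_bigr => k _; rewrite exp1n mul1n.
Qed.

(** What one more letter adds to [Z_a], beyond the [#|G|] copies of the smaller
    graph. *)
Definition zagreb_incr (a : nat) (G : sgraph) : nat :=
  (\sum_(y : G) deg y * pow_incr a (deg y))%N.

Lemma zagreb_incrE (a : nat) (G : sgraph) :
  zagreb_incr a G = (\sum_(1 <= j < a.+1) 'C(a, j - 1) * zagreb j G)%N.
Proof.
rewrite big_add1 /= big_mkord /zagreb_incr /pow_incr.
under eq_bigr => y _ do rewrite big_distrr /=.
rewrite exchange_big /=; apply: eq_bigr => k _.
rewrite subn1 /= /zagreb big_distrr /=; apply: eq_bigr => y _.
by rewrite expnS mulnCA.
Qed.

(** At most one letter [y] satisfies [u = y^(t+1)], so the correction in
    [deg_cons] is a single 0 or 1, and the power can be expanded. *)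
Lemma exp_deg_cons (G : sgraph) (a t : nat) (x : G) (u : t.+1.-tuple G) :
  (@deg (sierpinski G t.+2) [tuple of x :: u] ^ a =
   @deg (sierpinski G t.+1) u ^ a
   + \sum_(y : G) (u == [tuple of nseq t.+1 y]) * (adj x y * pow_incr a (deg y)))%N.
Proof.
rewrite deg_cons.
case: (pickP (fun z => u == [tuple of nseq t.+1 z])) => [z /eqP ->|H].
  rewrite deg_extreme.
  have -> : (\sum_y (adj x y && ([tuple of nseq t.+1 z] == [tuple of nseq t.+1 y]))
      = adj x z)%N.
    rewrite -[RHS](sum_delta z (fun y => adj x y : nat)); apply: eq_bigr => y _.
    by rewrite nseq_tuple_eq eq_sym mulnb andbC.
  have -> : (\sum_y ([tuple of nseq t.+1 z] == [tuple of nseq t.+1 y])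
      * (adj x y * pow_incr a (deg y)) = adj x z * pow_incr a (deg z))%N.
    rewrite -[RHS](sum_delta z (fun y => adj x y * pow_incr a (deg y))%N).
    by apply: eq_bigr => y _; rewrite nseq_tuple_eq eq_sym.
  by case: adj; rewrite ?mul1n ?expn_addn1 ?mul0n ?addn0.
rewrite !big1 ?addn0 // => y _; first by rewrite H.
by rewrite H andbF.
Qed.

Lemma zagreb_sierpinskiS (G : sgraph) (a t : nat) :
  (zagreb a (sierpinski G t.+2) =
   #|G| * zagreb a (sierpinski G t.+1) + zagreb_incr a G)%N.
Proof.
rewrite /zagreb sum_tuple_cons.
under eq_bigr => x _ do (under eq_bigr => u _ do rewrite exp_deg_cons).
under eq_bigr => x _ do rewrite big_split /=.
rewrite big_split /= sum_nat_const; congr addn.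
under eq_bigr => x _.
  rewrite exchange_big /=.
  under eq_bigr => y _ do rewrite sum_delta.
  over.
rewrite exchange_big /zagreb_incr; apply: eq_bigr => y _ /=.
rewrite -big_distrl /=; congr muln.
by rewrite deg_sum; apply: eq_bigr => x _; rewrite adj_sym.
Qed.

Lemma zagreb_sierpinski1 (G : sgraph) (a : nat) :
  zagreb a (sierpinski G 1) = zagreb a G.
Proof.
rewrite /zagreb sum_tuple_cons; apply: eq_bigr => x _.
under eq_bigr => u _ do rewrite deg_sierpinski1.
by rewrite sum_nat_const card_tuple expn0 mul1n.
Qed.

Lemma zagreb_sierpinski (G : sgraph) (a t : nat) :
  (zagreb a (sierpinski G t.+1) =
   #|G| ^ t * zagreb a G + (\sum_(i < t) #|G| ^ i) * zagreb_incr a G)%N.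
Proof.
elim: t => [|t IH].
  by rewrite zagreb_sierpinski1 big_ord0 expn0 mul1n mul0n addn0.
rewrite zagreb_sierpinskiS IH big_ord_recl expn0 mulnDr mulnDl mul1n expnS.
rewrite -!mulnA -addnA; congr addn; rewrite addnC; congr addn.
rewrite mulnA; congr (_ * _)%N.
by rewrite big_distrr /=; apply: eq_bigr => i _; rewrite -expnS.
Qed.

Theorem corollary2p3 (G : sgraph) (n alpha t : nat)
    (hG : #|G| = n) (hn : (2 <= n)%N) (ht : (1 <= t)%N) :
  (zagreb alpha (sierpinski G t))%:R =
    (n%:R ^+ t - n%:R ^+ (t - 1) + (n%:R ^+ (t - 1) - 1) * alpha%:R)
      / (n%:R - 1) * (zagreb alpha G)%:R
    + (n%:R ^+ (t - 1) - 1) / (n%:R - 1)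
      * (\sum_(1 <= j < alpha) 'C(alpha, j - 1)%:R * (zagreb j G)%:R)
  :> rat.
Proof.
case: t ht => // t _; rewrite subn1 /= zagreb_sierpinski hG.
have n1 : n%:R - 1 != 0 :> rat.
  by rewrite subr_eq0 -[1]/(1%:R) Num.Theory.eqr_nat; case: n hn {hG} => [|[]].
have geom : (\sum_(i < t) n ^ i)%N%:R = (n%:R ^+ t - 1) / (n%:R - 1) :> rat.
  rewrite subrX1 mulrC mulKf // natr_sum.
  by apply: eq_bigr => i _; rewrite natrX.
have incr : (zagreb_incr alpha G)%:R = alpha%:R * (zagreb alpha G)%:R
    + \sum_(1 <= j < alpha) 'C(alpha, j - 1)%:R * (zagreb j G)%:R :> rat.
  rewrite zagreb_incrE natr_sum.
  under eq_bigr => j _ do rewrite natrM.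
  case: alpha => [|a]; first by rewrite !big_geq // mul0r addr0.
  by rewrite big_nat_recr //= subn1 /= binSn addrC.
rewrite natrD !natrM natrX geom incr exprS.
by field.
Qed.
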